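(* Let $G$ be a finite group. The poset $\mathrm{AutCl}(G)$ is a chain (i.e. totally ordered) if and only if $G$ is (isomorphic to) one of the following: (1) a cyclic $p$-group for some prime $p$; (2) an elementary abelian $p$-group for some prime $p$; (3) the quaternion group $Q_8$ of order 8.
   Context: For a finite group $G$, let $L(G)$ be the set of subgroups of $G$. Define an equivalence relation on $L(G)$ by $H\equiv K$ iff there is $f\in\mathrm{Aut}(G)$ with $f(H)=K$; write $[H]$ for the class of $H$. $\mathrm{AutCl}(G)$ is the set $L(G)/\!\equiv$ of classes, partially ordered by: $[H]\lesssim[K]$ iff there are $H_1\in[H]$, $K_1\in[K]$ and $f\in\mathrm{Aut}(G)$ with $f(H_1)\subseteq K_1$. A $p$-group here is a finite group of order $p^k$ with $k\ge 0$ (so the trivial group is included); an elementary abelian $p$-group is a group isomorphic to $(\mathbb{Z}_p)^n$. *)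

(* Defs.v *)
From mathcomp Require Import all_boot all_fingroup all_algebra all_solvable.
From mathcomp Require Import mxabelem.

Set Implicit Arguments.
Unset Strict Implicit.
Unset Printing Implicit Defensive.

Import GroupScope.

Section AutClasses.

Variables (gT : finGroupType) (G : {group gT}).
Implicit Types (H K : {group gT}) (C D : {set {group gT}}).

(* Elements of Aut G are permutations of gT that fix every point outside G,   *)
(* so f @: H is the image f(H) whenever H is a subgroup of G.                 *)
Definition aut_equiv H K : bool :=
  [exists f in Aut G, f @: H == K :> {set gT}].

Definition aut_class H : {set {group gT}} :=
  [set K in subgroups G | aut_equiv H K].

Definition AutCl : {set {set {group gT}}} := [set aut_class H | H in subgroups G].

Definition AutCl_le C D : bool :=
  [exists H in C, exists K in D, exists f in Aut G, f @: H \subset K].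

Definition AutCl_chain : Prop := {in AutCl &, total AutCl_le}.

Lemma aut_equiv_refl H : aut_equiv H H.
Proof.
apply/existsP; exists 1; rewrite group1 /=; apply/eqP.
by rewrite (eq_imset _ (fun x => perm1 x)) imset_id.
Qed.

Lemma aut_equiv_sym H K : aut_equiv H K -> aut_equiv K H.
Proof.
case/exists_inP=> f Af /eqP fH; apply/exists_inP; exists f^-1; first exact: groupVr.
apply/eqP; rewrite -fH -imset_comp.
by rewrite (eq_imset _ (fun x => permK f x)) imset_id.
Qed.

Lemma aut_equiv_trans H K L : aut_equiv H K -> aut_equiv K L -> aut_equiv H L.
Proof.
case/exists_inP=> f Af /eqP fH /exists_inP[g Ag /eqP gK].
apply/exists_inP; exists (f * g); first exact: groupM.
by apply/eqP; rewrite -gK -fH -imset_comp; apply: eq_imset => x; rewrite permM.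
Qed.

Lemma AutCl_partition : partition AutCl (subgroups G).
Proof.
have eR : {in subgroups G & &, equivalence_rel aut_equiv}.
  move=> H K L _ _ _; split=> [|HK]; first exact: aut_equiv_refl.
  by apply/idP/idP; apply: aut_equiv_trans => //; apply: aut_equiv_sym.
exact: equivalence_partitionP eR.
Qed.

Lemma aut_class_eq H K :
  K \in subgroups G -> (aut_class H == aut_class K) = aut_equiv H K.
Proof.
move=> sK; apply/eqP/idP=> [/setP/(_ K) | HK].
  by rewrite !inE in sK *; rewrite sK aut_equiv_refl.
apply/setP=> L; rewrite !inE; congr (_ && _).
apply/idP/idP; apply: aut_equiv_trans => //; exact: aut_equiv_sym.
Qed.

Lemma AutCl_leE H K : H \in subgroups G -> K \in subgroups G ->
  AutCl_le (aut_class H) (aut_class K) = [exists f in Aut G, f @: H \subset K].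
Proof.
move=> sH sK; apply/idP/idP; last first.
  case/exists_inP=> f Af fHK; apply/exists_inP; exists H.
    by rewrite inE sH aut_equiv_refl.
  apply/exists_inP; exists K; first by rewrite inE sK aut_equiv_refl.
  by apply/exists_inP; exists f.
case/exists_inP=> H1 /setIdP[_ /exists_inP[a Aa /eqP aH]].
case/exists_inP=> K1 /setIdP[_ /aut_equiv_sym/exists_inP[b Ab /eqP bK]].
case/exists_inP=> f Af fH1; apply/exists_inP; exists (a * f * b).
  by rewrite !groupM.
rewrite -bK (eq_imset (g := b \o f \o a)) => [|x]; last by rewrite /= !permM.
rewrite (imset_comp (b \o f) a) aH (imset_comp b f); exact: imsetS.
Qed.

Lemma AutCl_le_refl : {in AutCl, reflexive AutCl_le}.
Proof.
move=> _ /imsetP[H sH ->]; rewrite AutCl_leE //.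
have /exists_inP[f Af /eqP fH] := aut_equiv_refl H.
by apply/exists_inP; exists f; rewrite ?fH.
Qed.

Lemma AutCl_le_anti : {in AutCl &, antisymmetric AutCl_le}.
Proof.
move=> _ _ /imsetP[H sH ->] /imsetP[K sK ->]; rewrite !AutCl_leE //.
case/andP=> /exists_inP[f Af fHK] /exists_inP[g _ gKH].
apply/eqP; rewrite aut_class_eq //; apply/exists_inP; exists f => //.
rewrite eqEcard fHK (card_imset _ (@perm_inj _ f)) /=.
rewrite -(card_imset (mem K) (@perm_inj _ g)); exact: subset_leq_card gKH.
Qed.

Lemma AutCl_le_trans : {in AutCl & &, transitive AutCl_le}.
Proof.
move=> _ _ _ /imsetP[K sK ->] /imsetP[H sH ->] /imsetP[L sL ->].
rewrite !AutCl_leE // => /exists_inP[f Af fHK] /exists_inP[g Ag gKL].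
apply/exists_inP; exists (f * g); first exact: groupM.
rewrite (eq_imset (g := g \o f)) => [|x]; last by rewrite /= permM.
rewrite (imset_comp g f); apply: subset_trans gKL; exact: imsetS.
Qed.

End AutClasses.

Lemma abelem_isog_rV (gT : finGroupType) (G : {group gT}) (p : nat) :
  prime p -> p.-abelem G <-> exists n, G \isog [set: 'rV['F_p]_n].
Proof.
move=> p_pr; split=> [abG | [n isoG]]; last by rewrite (isog_abelem isoG) mx_Fp_abelem.
exists (logn p #|G|); rewrite (isog_abelem_card _ abG) mx_Fp_abelem //=.
by rewrite cardsT card_mx card_Fp // mul1n -card_pgroup ?(abelem_pgroup abG).
Qed.

(* Main.v *)
(* AutCl(G) is a chain iff whenever |H| <= |K| some automorphism maps H into
   K; in particular a subgroup lies in every characteristic subgroup whose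
   order is at least its own. Cauchy's theorem then forces G to be a p-group,
   and Z(G) contains every element of order p. If Ohm_1(G) has order p, then
   G is cyclic or generalized quaternion, and in Q_(2^n) with n > 3 the
   characteristic subgroup G' = <x^2> would contain the element y of order 4
   outside <x>. Otherwise Ohm_1(G) is elementary abelian of order at least p^2, so
   it would contain every element of order p^2, hence there is none and
   G = Ohm_1(G). Conversely, in an elementary abelian group automorphisms are
   glued from complements, and in Q_8 two generators x, y of order 4 are
   exchanged by the automorphism whose graph in G x G is the quotient of Q_8
   generated by (x, y) and (y, x). *)

Require Import Defs.
From mathcomp Require Import all_boot all_fingroup all_algebra all_solvable.

Set Implicit Arguments.
Unset Strict Implicit.

Import GroupScope.

(** If an automorphism maps [K] into [H] although [#|H| <= #|K|], its image is all of [H], so its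
    inverse maps [H] onto [K]. *)
Lemma AutCl_chainP (gT : finGroupType) (G : {group gT}) :
  AutCl_chain G <->
  (forall H K : {group gT}, H \subset G -> K \subset G -> #|H| <= #|K| ->
     exists2 f, f \in Aut G & f @: H \subset K).
Proof.
split=> [chG H K sHG sKG leHK | trG _ _ /imsetP[H sHG ->] /imsetP[K sKG ->]].
  have [sH sK]: H \in subgroups G /\ K \in subgroups G by rewrite !inE.
  have := chG _ _ (imset_f _ sH) (imset_f _ sK).
  rewrite !AutCl_leE // => /orP[] /exists_inP[f Af sf]; first by exists f.
  have fKH: f @: K = H.
    by apply/eqP; rewrite eqEcard sf (card_imset _ (@perm_inj _ f)).
  exists f^-1; first exact: groupVr.
  by rewrite -fKH -imset_comp (eq_imset _ (permK f)) imset_id.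
rewrite !AutCl_leE //; rewrite !inE in sHG sKG.
have [leHK | /ltnW leKH] := leqP #|H| #|K|.
  have [f Af sf] := trG H K sHG sKG leHK.
  by apply/orP; left; apply/exists_inP; exists f.
have [f Af sf] := trG K H sKG sHG leKH.
by apply/orP; right; apply/exists_inP; exists f.
Qed.

(** An automorphism sending [H] into [K] also sends [K] onto itself, so injectivity pulls the
    inclusion back to [H]. *)
Lemma AutCl_chain_sub_char (gT : finGroupType) (G H K : {group gT}) :
  AutCl_chain G -> H \subset G -> K \char G -> #|H| <= #|K| -> H \subset K.
Proof.
move=> /AutCl_chainP trG sHG chK leHK; have sKG := char_sub chK.
have [f Af sfHK] := trG H K sHG sKG leHK.
have [_ /(_ _ (injm_autm Af) (im_autm Af)) fK] := charP _ _ chK.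
by rewrite -(injmSK (injm_autm Af)) // fK morphimEsub.
Qed.

Lemma AutCl_chain_pgroup (gT : finGroupType) (G : {group gT}) :
  AutCl_chain G -> exists2 p : nat, prime p & p.-group G.
Proof.
move=> /AutCl_chainP trG; have [-> | ntG] := eqsVneq G 1%G.
  by exists 2; rewrite ?pgroup1.
have G_gt1: 1 < #|G| by rewrite cardG_gt1.
have p_pr := pdiv_prime G_gt1; exists (pdiv #|G|) => //.
apply/pgroupP=> q q_pr q_dv_G.
have [x Gx ox] := Cauchy p_pr (pdiv_dvd _); have [y Gy oy] := Cauchy q_pr q_dv_G.
(* The cycle of [u] embeds in that of [v], so one prime order divides the other. *)
have eq_orders (u v : gT) : u \in G -> v \in G -> prime #[u] -> prime #[v] ->
  #[u] <= #[v] -> #[u] = #[v].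
  rewrite -!cycle_subG => sUG sVG u_pr v_pr leuv.
  have [f Af] := trG <[u]>%G <[v]>%G sUG sVG leuv.
  rewrite -(autmE Af) -morphimEsub // => /cardSg.
  by rewrite card_injm ?injm_autm // dvdn_prime2 // => /eqP.
by rewrite inE -oy -ox; case: (leqP #[x] #[y]) => [|/ltnW] /eq_orders->; rewrite ?ox ?oy.
Qed.

Lemma AutCl_chain_abelem (gT : finGroupType) (G : {group gT}) (p : nat) :
  AutCl_chain G -> p.-group G -> G :!=: 1 -> #|'Ohm_1(G)| != p -> p.-abelem G.
Proof.
move=> chG pG ntG oG1; have [p_pr p_dv_G _] := pgroup_pdiv pG ntG.
have [_ p_dv_Z _] := pgroup_pdiv (pgroupS (center_sub G) pG)
                       (contra_neq (trivg_center_pgroup pG) ntG).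
have sG1Z: 'Ohm_1(G) \subset 'Z(G).
  rewrite (OhmE 1 pG) gen_subG; apply/subsetP=> x /LdivP[Gx xp].
  rewrite -cycle_subG; apply: (AutCl_chain_sub_char chG); rewrite ?cycle_subG ?center_char //.
  apply: dvdn_leq; rewrite ?cardG_gt0 // (dvdn_trans _ p_dv_Z) //.
  by rewrite -orderE order_dvdn xp.
have abG1: p.-abelem 'Ohm_1(G).
  by rewrite abelem_Ohm1 //; apply: abelianS sG1Z (center_abelian G).
have leG1: p ^ 2 <= #|'Ohm_1(G)|.
  have [[|[|k]] oG1k] := p_natP (abelem_pgroup abG1).
  - by case/eqP: ntG; apply/eqP; rewrite -(Ohm1_eq1 G) trivg_card1 oG1k.
  - by rewrite oG1k expn1 eqxx in oG1.
  by rewrite oG1k leq_exp2l // prime_gt1.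
suffices ->: G :=: 'Ohm_1(G) by [].
apply/eqP; rewrite eqEsubset Ohm_sub andbT; apply/subsetP=> g Gg.
rewrite (OhmE 1 pG) mem_gen // !inE Gg -order_dvdn /=.
have [[|[|k]] og] := p_natP (mem_p_elt pG Gg); rewrite og //.
(* Only [#[g] = p ^ k.+2] remains, and this power of [g] then has order [p ^ 2]. *)
pose h := g ^+ (p ^ k); have Gh: h \in G by rewrite groupX.
have oh: #[h] = (p ^ 2)%N.
  by rewrite orderXdiv og -addn2 expnD ?dvdn_mulr // mulKn // expn_gt0 prime_gt0.
have: h \in 'Ohm_1(G).
  by rewrite -cycle_subG (AutCl_chain_sub_char chG) ?cycle_subG ?Ohm_char // -orderE oh.
move/(abelem_order_p abG1); case: (eqVneq h 1) oh => [-> | _ ->].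
  by rewrite order1 => /esym/eqP; rewrite (eqn_exp2l 2 0 (prime_gt1 p_pr)).
by move=> /(_ isT)/eqP; rewrite (eqn_exp2l 2 1 (prime_gt1 p_pr)).
Qed.

Lemma AutCl_chain_quaternion (gT : finGroupType) (G : {group gT}) n :
  AutCl_chain G -> n > 2 -> G \isog 'Q_(2 ^ n) -> n = 3.
Proof.
move=> chG n_gt2 isoG; have [[x y] genG [oy _ _]] := generators_quaternion n_gt2 isoG.
have [_ [defG' _ oG' _] _ _ _] := quaternion_structure n_gt2 genG isoG.
case: genG => _ Gx _ /setDP[Gy]; apply: contraNeq => n_neq3.
have n_gt3: 3 < n by rewrite ltn_neqAle eq_sym n_neq3.
suffices: <[y]> \subset G^`(1).
  by rewrite cycle_subG /= defG'; apply/subsetP/cycleX.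
apply: (@AutCl_chain_sub_char _ _ _ G^`(1)%G chG); rewrite ?cycle_subG ?der_char //.
(* The derived subgroup has order [2 ^ (n - 2)], which reaches [#[y] = 4] once [n > 3]. *)
by rewrite -orderE oy oG' -(subnKC n_gt3) (@leq_exp2l 2 2).
Qed.

(** In a cyclic group, inclusion of subgroups amounts to divisibility of their orders, and powers of
    one prime are comparable, so the identity automorphism suffices. *)
Lemma cyclic_pgroup_chain (gT : finGroupType) (G : {group gT}) (p : nat) :
  prime p -> p.-group G -> cyclic G -> AutCl_chain G.
Proof.
move=> p_pr pG cycG; apply/AutCl_chainP=> H K sHG sKG leHK; exists 1; first exact: group1.
rewrite (eq_imset _ (fun x => perm1 x)) imset_id -(cardSg_cyclic cycG) //.
have [[i oH] [j oK]] := (p_natP (pgroupS sHG pG), p_natP (pgroupS sKG pG)).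
by move: leHK; rewrite oH oK leq_exp2l ?prime_gt1 //; apply: dvdn_exp2l.
Qed.

Lemma abelem_chain (gT : finGroupType) (G : {group gT}) (p : nat) :
  prime p -> p.-abelem G -> AutCl_chain G.
Proof.
move=> p_pr abG; have [pG cGG _] := and3P abG; apply/AutCl_chainP=> H L sHG sLG leHL.
(* The target of [H] is a subgroup of [L] of the same order: a p-group has subgroups of every order
   [p ^ i] up to its own. *)
have [K [sKL _ oK]]: exists K : {group gT}, [/\ K \subset L, K <| L & #|K| = #|H|].
  have pL := pgroupS sLG pG; rewrite (card_pgroup (pgroupS sHG pG)).
  apply: normal_pgroup => //.
  have leHLp := leHL; rewrite (card_pgroup (pgroupS sHG pG)) (card_pgroup pL) in leHLp.
  by rewrite -(leq_exp2l _ _ (prime_gt1 p_pr)).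
have sKG := subset_trans sKL sLG.
have compl (A : {group gT}) : A \subset G -> exists2 B : {group gT}, B \subset G & A \x B = G.
  move=> sAG; have /splitsP[B /complP[tiAB defG]] := abelem_splits abG sAG.
  have sBG: B \subset G by rewrite -defG mulG_subr.
  by exists B => //; rewrite dprodE //; apply: centSS cGG.
have [H' sH'G defH] := compl H sHG; have [K' sK'G defK] := compl K sKG.
have isoA (A B : {group gT}) : A \subset G -> B \subset G -> #|A| = #|B| -> A \isog B.
  move=> sAG sBG oAB; rewrite (isog_abelem_card _ (abelemS sAG abG)).
  by rewrite (abelemS sBG abG) oAB /=.
have /isogP[f injf fH] := isoA H K sHG sKG (esym oK).
have oK': #|H'| = #|K'|.
  apply/eqP; rewrite -(eqn_pmul2l (cardG_gt0 H)) (dprod_card defH) -oK.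
  by rewrite (dprod_card defK).
have /isogP[g injg gH'] := isoA H' K' sH'G sK'G oK'.
have cfg: g @* H' \subset 'C(f @* H) by rewrite fH gH'; apply: centSS cGG.
have [_ defG _ tiKK'] := dprodP defK.
have injfg: 'injm (dprodm defH cfg) by rewrite injm_dprodm injf injg fH gH' tiKK' /=.
have imfg: dprodm defH cfg @* G = G by rewrite im_dprodm fH gH'.
exists (aut injfg imfg); first exact: Aut_aut.
by rewrite imset_autE // morphim_dprodml // fH.
Qed.

(** Both projections of [D] are onto [G], so the bound on [#|D|] makes them injective; [D] is then
    the graph of the second projection composed with the inverse of the first. *)
Lemma Aut_graph (gT : finGroupType) (G : {group gT}) (D : {group gT * gT}) :
    @fst gT gT @* D = G -> @snd gT gT @* D = G -> #|D| <= #|G| ->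
  exists2 f, f \in Aut G & forall u, u \in D -> f u.1 = u.2.
Proof.
move=> fstD sndD leDG.
have injD (h : {morphism D >-> gT}) : h @* D = G -> 'injm h.
  by move=> hD; rewrite -card_im_injm eqn_leq leq_morphim hD.
pose p1 := [morphism of restrm (subsetT D) (@fst gT gT)].
pose p2 := [morphism of restrm (subsetT D) (@snd gT gT)].
have p1D : p1 @* D = G by rewrite morphim_restrm setIid.
have p2D : p2 @* D = G by rewrite morphim_restrm setIid.
have inj1 := injD _ p1D; have inj2 := injD _ p2D.
have injp : 'injm (ifactm p2 inj1) by rewrite injm_ifactm.
have imp : ifactm p2 inj1 @* (p1 @* D) = p1 @* D.
  by rewrite morphim_ifactm // p1D.
exists (aut injp imp) => [|u Du].
  (* The automorphism is built on [p1 @* D], which is equal to [G] but not convertible to it. *)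
  have <- : Aut (p1 @* D) = Aut G by rewrite p1D.
  exact: Aut_aut.
rewrite autE; last exact: mem_morphim.
exact: (ifactmE p2 inj1 Du).
Qed.

(** Any [x] of order 4 and any [y] outside its cycle form a pair of extremal generators, so the
    structure of quaternion groups applies to every such pair. *)
Lemma quaternion8_structure (gT : finGroupType) (G : {group gT}) x y :
    G \isog 'Q_8 -> x \in G -> y \in G -> #[x] = 4 -> y \notin <[x]> ->
  [/\ forall u, u \in G -> #[u] = 2 -> u = x ^+ 2,
      #[y] = 4 & x ^ y = x^-1].
Proof.
move=> isoG Gx Gy ox X'y.
have genG : extremal_generators G 2 3 (x, y).
  by split; rewrite ?inE ?X'y // (card_isog isoG) (@card_quaternion 3).
have [[_ ordG invG] _ [_ _ invol _ _] _ _] := @quaternion_structure _ _ 3 _ _ isT genG isoG.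
by split; [exact: invol | apply: ordG | apply: invG]; rewrite ?inE ?X'y ?cycle_id.
Qed.

Lemma quaternion8_Aut_trans (gT : finGroupType) (G : {group gT}) x y :
    G \isog 'Q_8 -> x \in G -> y \in G -> #[x] = 4 -> y \notin <[x]> ->
  exists2 f, f \in Aut G & f x = y.
Proof.
move=> isoG Gx Gy ox X'y.
have [invol oy xy] := quaternion8_structure isoG Gx Gy ox X'y.
(* This makes the hypotheses symmetric, giving the same relations with [x] and [y] exchanged. *)
have Y'x : x \notin <[y]>.
  apply: contra X'y => Yx; have /eqP-> : <[x]> == <[y]>; last exact: cycle_id.
  by rewrite eqEcard cycle_subG Yx -!orderE ox oy.
have [_ _ yx] := quaternion8_structure isoG Gy Gx oy Y'x.
have yx2 : y ^+ 2 = x ^+ 2 by rewrite -(invol (y ^+ 2)) ?groupX // orderXdiv oy.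
have defG : <[x]> <*> <[y]> = G.
  have genG : extremal_generators G 2 3 (x, y).
    by split; rewrite ?inE ?X'y // (card_isog isoG) (@card_quaternion 3).
  have [_ _ _ <- nXY] := @extremal_generators_facts _ _ 2 3 _ _ isT genG.
  by rewrite norm_joinEr.
pose a : gT * gT := (x, y); pose b : gT * gT := (y, x).
(* The defining relations of ['Q_8] hold for [(x, y)] in the first coordinate and for [(y, x)] in
   the second, hence for [a] and [b]. *)
have homD : (<[a]> <*> <[b]>) \homg 'Q_8.
  rewrite (@Grp_quaternion 3) //; apply/existsP; exists (a, b) => /=.
  have e4 (u : gT) : #[u] = 4 -> u * (u * (u * u)) = 1.
    by move=> ou; have := expg_order u; rewrite ou.
  rewrite !xpair_eqE !eqxx /= !e4 // !eqxx /=; apply/and3P; split; first 1 last.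
  - exact/eqP.
  - exact/eqP.
  by apply/andP; split; apply/eqP.
have leD : #|<[a]> <*> <[b]>| <= #|G|.
  by rewrite (card_isog isoG) dvdn_leq // card_homg.
have morC (h : {morphism [set: gT * gT] >-> gT}) :
    h @* (<[a]> <*> <[b]>) = <[h a]> <*> <[h b]>.
  by rewrite morphimY ?subsetT // !morphim_cycle ?inE.
have [||//|f Af fE] := @Aut_graph _ G (<[a]> <*> <[b]>).
- by rewrite morC.
- by rewrite morC /= joingC.
by exists f => //; apply: (fE a); rewrite mem_gen // inE cycle_id.
Qed.

Lemma quaternion8_chain (gT : finGroupType) (G : {group gT}) :
  G \isog 'Q_8 -> AutCl_chain G.
Proof.
move=> isoG; have oG : #|G| = 8 by rewrite (card_isog isoG) (@card_quaternion 3).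
have [z invol] : exists z, forall u, u \in G -> #[u] = 2 -> u = z.
  have [[x y] [_ Gx ox /setDP[Gy X'y]] _] := @generators_quaternion _ _ 3 isT isoG.
  by have [invol _ _] := quaternion8_structure isoG Gx Gy ox X'y; exists (x ^+ 2).
(* Four elements do not fit in [[set 1; z]], so some element has order neither 1 nor 2. *)
have gen4 (H : {group gT}) : H \subset G -> #|H| = 4 -> exists2 x, #[x] = 4 & H :=: <[x]>.
  move=> sHG oH; have /subsetPn[x Hx] : ~~ (H \subset [set 1; z]).
    by apply/negP=> /subset_leq_card; rewrite oH cards2; case: (1 != z).
  rewrite !inE negb_or => /andP[ntx xz].
  have ox : #[x] = 4.
    have: #[x] %| 2 ^ 2 by have := order_dvdG Hx; rewrite oH.
    case/dvdn_pfactor=> // [[|[|[|]]]] // _ ox.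
      by rewrite -order_eq1 ox in ntx.
    by case/eqP: xz; apply: invol => //; apply: (subsetP sHG).
  by exists x => //; apply/eqP; rewrite eq_sym eqEcard cycle_subG Hx oH -orderE ox.
apply/AutCl_chainP=> H K sHG sKG leHK.
have [sHK | not_sHK] := boolP (H \subset K).
  exists 1; first exact: group1.
  by rewrite (eq_imset _ (fun x => perm1 x)) imset_id.
have dv8 (A : {group gT}) : A \subset G -> exists2 i, i <= 3 & #|A| = (2 ^ i)%N.
  by move/cardSg; rewrite oG => /(@dvdn_pfactor 2 _ 3)-/(_ isT)[i]; exists i.
(* All other orders force [H \subset K]: either [K] is [G], or [#|H| <= 2] and, for nontrivial [H],
   Cauchy's theorem puts the unique involution [z] in [K]. *)
have [oH oK] : #|H| = 4 /\ #|K| = 4.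
  have [i _ oH] := dv8 H sHG; have [j le_j oK] := dv8 K sKG.
  have lt_j : j < 3.
    rewrite ltn_neqAle le_j andbT; apply: contraNneq not_sHK => j3.
    suffices -> : K :=: G by [].
    by apply/eqP; rewrite eqEcard sKG oG oK j3.
  have le_ij : i <= j by rewrite oH oK leq_exp2l in leHK.
  have gt_i : 1 < i.
    rewrite ltnNge; apply: contra not_sHK => le_i1; apply/subsetP=> u Hu.
    have [-> | ntu] := eqVneq u 1; first exact: group1.
    have ou : #[u] = 2.
      apply/prime_nt_dvdP; rewrite ?order_eq1 //.
      by rewrite (dvdn_trans (order_dvdG Hu)) // oH (@dvdn_exp2l 2 i 1).
    have p2K : 2 %| #|K|.
      by rewrite -ou (dvdn_trans (order_dvdG Hu)) // oH oK dvdn_exp2l.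
    have [v Kv ov] := Cauchy (isT : prime 2) p2K.
    by rewrite (invol u) ?(subsetP sHG) // -(invol v) ?(subsetP sKG).
  have j2 : j = 2 by apply/eqP; rewrite eqn_leq -ltnS lt_j (leq_trans gt_i).
  have i2 : i = 2 by apply/eqP; rewrite eqn_leq gt_i andbT -j2.
  by rewrite oH oK i2 j2.
have [[x ox defH] [y oy defK]] := (gen4 H sHG oH, gen4 K sKG oK).
rewrite defH defK in not_sHK *.
have Gx : x \in G by rewrite -cycle_subG -defH.
have Gy : y \in G by rewrite -cycle_subG -defK.
have X'y : y \notin <[x]>.
  apply: contra not_sHK => Xy; have /eqP<- // : <[y]> == <[x]>.
  by rewrite eqEcard cycle_subG Xy -!orderE ox oy.
have [f Af fx] := quaternion8_Aut_trans isoG Gx Gy ox X'y; exists f => //.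
rewrite -(autmE Af) -morphimEsub ?cycle_subG // morphim_cycle //=.
by rewrite autmE fx.
Qed.

Theorem theorem3p3 (gT : finGroupType) (G : {group gT}) :
  AutCl_chain G <->
  [\/ exists p : nat, [/\ prime p, p.-group G & cyclic G],
      exists p : nat, prime p /\ p.-abelem G
    | G \isog 'Q_8].
Proof.
split=> [chG | [[p [p_pr pG cG]] | [p [p_pr abG]] | isoG]].
- have [p p_pr pG] := AutCl_chain_pgroup chG.
  (* The trivial group is put with the cyclic ones, as the arguments on ['Ohm_1(G)] below assume [G]
     nontrivial. *)
  have [G1 | ntG] := eqVneq (G : {set gT}) 1.
    by constructor 1; exists p; rewrite p_pr pG G1 cyclic1.
  have [oG1 | G1_neq] := eqVneq #|'Ohm_1(G)| p; last first.
    by constructor 2; exists p; split=> //; apply: AutCl_chain_abelem.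
  have := introT (prime_Ohm1P pG ntG) oG1.
  case/orP=> [cG | /andP[_ /eqP/quaternion_classP[n n_gt2 isoG]]].
    by constructor 1; exists p.
  by constructor 3; move: (isoG); rewrite (AutCl_chain_quaternion chG n_gt2 isoG).
- exact: cyclic_pgroup_chain p_pr pG cG.
- exact: abelem_chain p_pr abG.
- exact: quaternion8_chain.
Qed.
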